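(* For each variety $\mathbf{K}\in\Xi(\mathbf{S4})$, $$\mathsf{Log}(\sigma(\rho(\mathbf{K})))=Schem(\mathsf{Log}(\mathbf{K})^{\Box}).$$ Consequently, a logic (in the sense of axiomatic extension) $L\in\mathbf{NExt}(\mathsf{S4})$ is $\Box$-maximal if and only if it is the greatest modal companion of $\rho(L)$.
   Context: $\mathbf{S4}$ is the variety of S4-algebras: Boolean algebras with a unary $\Box$ satisfying $\Box1=1$, $\Box(a\wedge b)=\Box a\wedge\Box b$, $\Box a\le a$, $\Box a\le\Box\Box a$. In this statement $\Xi(\mathbf{S4})$ is the lattice of subvarieties of $\mathbf{S4}$. $\mathbf{NExt}(\mathsf{S4})$ is the lattice of normal axiomatic extensions of $\mathsf{S4}$ (sets of modal formulas), and $\Lambda(\mathsf{IPC})$ is the lattice of axiomatic extensions (superintuitionistic logics) of $\mathsf{IPC}$. For a class $\mathbf{K}$ of algebras, $\mathsf{Log}(\mathbf{K})$ is the set of formulas $\phi$ such that $\phi\approx1$ is valid in all members of $\mathbf{K}$. The translation $GMT$ from intuitionistic to modal formulas: $GMT(p)=\Box p$, $GMT(\top)=\top$, $GMT(\bot)=\bot$, $GMT$ commutes with $\wedge,\vee$, and $GMT(\phi\to\psi)=\Box(\neg GMT(\phi)\vee GMT(\psi))$. $M\in\mathbf{NExt}(\mathsf{S4})$ is a modal companion of $L\in\Lambda(\mathsf{IPC})$ if for all intuitionistic $\phi$: $\phi\in L\iff GMT(\phi)\in M$. For $M\in\mathbf{NExt}(\mathsf{S4})$, $\rho(M)=\{\phi:GMT(\phi)\in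 M\}\in\Lambda(\mathsf{IPC})$. For an S4-algebra $\mathcal{B}$, $\mathcal{B}_\Box=\{a\in B:a=\Box a\}$ is a Heyting algebra with the inherited $0,1,\wedge,\vee$ and implication $\Box(\neg a\vee b)$. For a variety $\mathbf{K}$ of S4-algebras, $\rho(\mathbf{K})=\{\mathcal{B}_\Box:\mathcal{B}\in\mathbf{K}\}$. For a Heyting algebra $\mathcal{H}$, $B(\mathcal{H})$ is its Boolean envelope: the Boolean algebra generated by $\mathcal{H}$, realized inside the powerset of the set of prime filters of $\mathcal{H}$ via $a\mapsto\{x:a\in x\}$, with $\Box\bigl(\bigwedge_{i=1}^n(\neg c_i\vee d_i)\bigr)=\bigwedge_{i=1}^n(c_i\to d_i)$ for $c_i,d_i\in H$, where $\to$ is Heyting implication; it is an S4-algebra. For a variety $\mathbf{P}$ of Heyting algebras, $\sigma(\mathbf{P})=\mathbb{HSP}\{B(\mathcal{H}):\mathcal{H}\in\mathbf{P}\}$. For $L\in\mathbf{NExt}(\mathsf{S4})$, its $\Box$-variant is $L^\Box=\{\phi:\phi[\Box\overline p/\overline p]\in L\}$, where $\phi[\Box\overline p/\overline p]$ substitutes $\Box q$ for each proposition letter $q$. For a $\Box$-variant $L'$, $Schem(L')=\{\phi:\forall\overline\psi,\ \phi[\overline\psi/\overline p]\in L'\}$, with $\overline\psi$ ranging over substitutions of modal formulas for proposition letters. $L$ is $\Box$-maximal if for every $S\in\mathbf{NExt}(\mathsf{S4})$, $L^\Box=S^\Box$ implies $S\subseteq L$. *)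

(* Defs.v *)
From HB Require Import structures.
From mathcomp Require Import all_boot all_order.
From mathcomp Require Import boolp classical_sets.

Set Implicit Arguments.
Unset Strict Implicit.
Unset Printing Implicit Defensive.

Import Order.Theory.
Local Open Scope order_scope.

(* The display only tags notations, so fixing it is no loss of generality and
   lets a class of algebras be a predicate on a single type of structures. *)
Fact alg_display : Order.disp_t. Proof. exact: (Order.Disp tt tt). Qed.

HB.mixin Record hasHeytingImp H of Order.TBDistrLattice alg_display H := {
  himp : H -> H -> H;
  le_himp : forall a b c : H, (a `&` b <= c) = (a <= himp b c)
}.

#[short(type="heytingType")]
HB.structure Definition Heyting :=
  { H of Order.TBDistrLattice alg_display H & hasHeytingImp H }.

HB.mixin Record hasS4Box B of Order.CTBDistrLattice alg_display B := {
  box : B -> B;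
  box1 : box \top = \top;
  boxI : forall a b : B, box (a `&` b) = box a `&` box b;
  box_le : forall a : B, box a <= a;
  le_boxbox : forall a : B, box a <= box (box a)
}.

#[short(type="s4AlgType")]
HB.structure Definition S4Algebra :=
  { B of Order.CTBDistrLattice alg_display B & hasS4Box B }.

Record heyting_hom (G H : heytingType) (f : G -> H) : Prop := HeytingHom {
  heyting_hom0 : f \bot = \bot;
  heyting_hom1 : f \top = \top;
  heyting_homI : {morph f : a b / a `&` b};
  heyting_homU : {morph f : a b / a `|` b};
  heyting_hom_imp : {morph f : a b / himp a b}
}.

Record s4_hom (A B : s4AlgType) (f : A -> B) : Prop := S4Hom {
  s4_hom0 : f \bot = \bot;
  s4_hom1 : f \top = \top;
  s4_homI : {morph f : a b / a `&` b};
  s4_homU : {morph f : a b / a `|` b};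
  s4_homC : {morph f : a / ~` a};
  s4_hom_box : {morph f : a / box a}
}.

Section HeytingTheory.
Variable H : heytingType.
Implicit Types a b c : H.

Lemma himp_mp a b : a `&` himp a b <= b.
Proof. by rewrite meetC le_himp. Qed.

Lemma himp1x a : himp \top a = a.
Proof.
apply/eqP; rewrite eq_le -[X in X <= a]meet1x himp_mp /=.
by rewrite -le_himp meetx1.
Qed.

End HeytingTheory.

Definition s4_prod (I : Type) (B : I -> s4AlgType) : Type := forall i, B i.

Section S4Product.
Variables (I : Type) (B : I -> s4AlgType).
Local Notation T := (s4_prod B).
Implicit Types f g h : T.

HB.instance Definition _ := Choice.on T.

Definition prod_meet f g : T := fun i => f i `&` g i.
Definition prod_join f g : T := fun i => f i `|` g i.
Definition prod_compl f : T := fun i => ~` f i.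
Definition prod_bot : T := fun=> \bot.
Definition prod_top : T := fun=> \top.
Definition prod_box f : T := fun i => box (f i).
Definition prod_le f g := prod_meet f g == f.
Definition prod_lt f g := (g != f) && prod_le f g.

Let pmeetC : commutative prod_meet.
Proof. by move=> f g; apply/functional_extensionality_dep => i; exact: meetC. Qed.
Let pjoinC : commutative prod_join.
Proof. by move=> f g; apply/functional_extensionality_dep => i; exact: joinC. Qed.
Let pmeetA : associative prod_meet.
Proof. by move=> f g h; apply/functional_extensionality_dep => i; exact: meetA. Qed.
Let pjoinA : associative prod_join.
Proof. by move=> f g h; apply/functional_extensionality_dep => i; exact: joinA. Qed.
Let pjoinKI g f : prod_meet f (prod_join f g) = f.
Proof. by apply/functional_extensionality_dep => i; exact: joinKI. Qed.
Let pmeetKU g f : prod_join f (prod_meet f g) = f.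
Proof. by apply/functional_extensionality_dep => i; exact: meetKU. Qed.
Let pmeetUl : left_distributive prod_meet prod_join.
Proof. by move=> f g h; apply/functional_extensionality_dep => i; exact: meetUl. Qed.
Let pmeetxx : idempotent_op prod_meet.
Proof. by move=> f; apply/functional_extensionality_dep => i; exact: meetxx. Qed.

HB.instance Definition _ := Order.isMeetJoinDistrLattice.Build alg_display T
  (fun _ _ => erefl : prod_le _ _ = _) (fun _ _ => erefl : prod_lt _ _ = _)
  pmeetC pjoinC pmeetA pjoinA pjoinKI pmeetKU pmeetUl pmeetxx.

Lemma prod_leP f g : reflect (forall i, f i <= g i) (f <= g).
Proof.
apply: (iffP eqP) => [fg i|fg]; last first.
  by apply/functional_extensionality_dep => i; apply: meet_l; exact: fg.
by apply/meet_idPl; exact: (congr1 (fun h : T => h i) fg).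
Qed.

Let ple0x f : prod_bot <= f.
Proof. by apply/prod_leP => i; exact: le0x. Qed.
Let plex1 f : f <= prod_top.
Proof. by apply/prod_leP => i; exact: lex1. Qed.

HB.instance Definition _ := Order.hasBottom.Build alg_display T ple0x.
HB.instance Definition _ := Order.hasTop.Build alg_display T plex1.

Let pjoinxC f : f `|` prod_compl f = \top.
Proof. by apply/functional_extensionality_dep => i; exact: joinxC. Qed.
Let pmeetxC f : f `&` prod_compl f = \bot.
Proof. by apply/functional_extensionality_dep => i; exact: meetxC. Qed.

HB.instance Definition _ :=
  Order.TBDistrLattice_hasComplement.Build alg_display T pjoinxC pmeetxC.

Let pbox1 : prod_box \top = \top.
Proof. by apply/functional_extensionality_dep => i; exact: box1. Qed.
Let pboxI f g : prod_box (f `&` g) = prod_box f `&` prod_box g.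
Proof. by apply/functional_extensionality_dep => i; exact: boxI. Qed.
Let pbox_le f : prod_box f <= f.
Proof. by apply/prod_leP => i; exact: box_le. Qed.
Let ple_boxbox f : prod_box f <= prod_box (prod_box f).
Proof. by apply/prod_leP => i; exact: le_boxbox. Qed.

HB.instance Definition _ := hasS4Box.Build T pbox1 pboxI pbox_le ple_boxbox.

End S4Product.

Definition opH (K : s4AlgType -> Prop) (A : s4AlgType) : Prop :=
  exists (B : s4AlgType) (f : B -> A),
    [/\ K B, s4_hom f & forall a, exists b, f b = a].

Definition opS (K : s4AlgType -> Prop) (A : s4AlgType) : Prop :=
  exists (B : s4AlgType) (f : A -> B), [/\ K B, s4_hom f & injective f].

Definition opP (K : s4AlgType -> Prop) (A : s4AlgType) : Prop :=
  exists (I : Type) (B : I -> s4AlgType) (f : A -> s4_prod B),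
    [/\ forall i, K (B i), s4_hom f & bijective f].

Definition variety (K : s4AlgType -> Prop) : Prop :=
  [/\ forall A, opH K A -> K A,
      forall A, opS K A -> K A &
      forall A, opP K A -> K A].

Section OpenAlgebra.
Variable B : s4AlgType.

Definition is_open : pred B := fun a => a == box a.
Definition open_alg : Type := {a : B | is_open a}.

HB.instance Definition _ := SubChoice.on open_alg.

Lemma le_box (a b : B) : a <= b -> box a <= box b.
Proof. by rewrite !leEmeet -boxI => /eqP ->. Qed.

Lemma box_box (a : B) : box (box a) = box a.
Proof. by apply/eqP; rewrite eq_le box_le le_boxbox. Qed.

Let open_meet : {in is_open &, forall a b, a `&` b \in is_open}.
Proof. by move=> a b /eqP ao /eqP bo; apply/eqP; rewrite boxI -ao -bo. Qed.

Let open_join : {in is_open &, forall a b, a `|` b \in is_open}.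
Proof.
move=> a b /eqP ao /eqP bo; apply/eqP/le_anti; rewrite box_le andbT.
by rewrite leUx; apply/andP; split; [rewrite {1}ao|rewrite {1}bo]; rewrite le_box ?leUl ?leUr.
Qed.

Let open_bot : \bot \in is_open.
Proof. by apply/eqP/le_anti; rewrite le0x box_le. Qed.

Let open_top : \top \in is_open.
Proof. by apply/eqP; rewrite box1. Qed.

HB.instance Definition _ := Order.isTBLatticeClosed.Build alg_display B is_open
  open_meet open_join open_bot open_top.

HB.instance Definition _ :=
  [SubChoice_isTBSubLattice of open_alg by <: with alg_display].


Lemma val_openI (x y : open_alg) : val (x `&` y) = val x `&` val y.
Proof. exact: Order.valI_subproof. Qed.

Lemma val_openU (x y : open_alg) : val (x `|` y) = val x `|` val y.
Proof. exact: Order.valU_subproof. Qed.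

Let open_meetUl : @left_distributive open_alg open_alg Order.meet Order.join.
Proof. by move=> x y z; apply: val_inj; rewrite !(val_openI, val_openU) meetUl. Qed.

HB.instance Definition _ :=
  Order.Lattice_Meet_isDistrLattice.Build alg_display open_alg open_meetUl.

Let open_imp_subproof (x y : open_alg) : is_open (box (~` val x `|` val y)).
Proof. by rewrite /is_open box_box. Qed.

Definition open_imp (x y : open_alg) : open_alg := Sub _ (open_imp_subproof x y).

Let open_le_imp (x y z : open_alg) : (x `&` y <= z) = (x <= open_imp y z).
Proof.
rewrite -!Order.le_val val_openI SubK; apply/idP/idP => [h|h].
  rewrite (eqP (valP x : val x == box (val x))) le_box //.
  by rewrite -leBLR diffE complK.
rewrite -[val z]join0x; apply: le_trans (leI2 (le_trans h (box_le _)) (lexx _)) _.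
by rewrite meetUl meetCx leUx le0x /= join0x leIl.
Qed.

HB.instance Definition _ := hasHeytingImp.Build open_alg open_le_imp.

End OpenAlgebra.

Section PrimeFilters.
Variable H : heytingType.

Record is_filter (F : set H) : Prop := IsFilter {
  filter_top : F \top;
  filter_meet : forall a b, F a -> F b -> F (a `&` b);
  filter_up : forall a b, a <= b -> F a -> F b
}.

Record is_prime_filter (F : set H) : Prop := IsPrimeFilter {
  prime_is_filter : is_filter F;
  prime_bot : ~ F \bot;
  prime_join : forall a b, F (a `|` b) -> F a \/ F b
}.

Definition prime_filter : Type := {F : set H | is_prime_filter F}.

Lemma prime_filter_separation (a b : H) :
  ~~ (a <= b) -> exists x : prime_filter, sval x a /\ ~ sval x b.
Proof.
move=> nab.
pose Q (F : set H) := [/\ is_filter F, F a & ~ F b].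
have [|M [PM maxM]] := @Zorn_bigcup H [set F | F = set0 \/ Q F].
  move=> C CP Ctot.
  have [[F0 [CF0 QF0]]|nQ] := pselect (exists F, C F /\ Q F); last first.
    left; rewrite -subset0 => z [F CF Fz]; case: (CP _ CF) => [F0|QF].
      by rewrite F0 in Fz.
    by case: nQ; exists F.
  have CQ F z : C F -> F z -> Q F.
    by move=> CF Fz; case: (CP _ CF) => // F1; rewrite F1 in Fz.
  have [[F0t _ _] F0a _] := QF0.
  right; split; last 2 first.
  - by exists F0.
  - by case=> F CF Fb; case: (CQ _ _ CF Fb).
  split; first by exists F0.
  - move=> c d [F CF Fc] [G CG Gd].
    have [FG|GF] := Ctot _ _ CF CG.
      exists G => //; have [[_ GI _] _ _] := CQ _ _ CG Gd.
      by apply: GI => //; exact: FG.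
    exists F => //; have [[_ FI _] _ _] := CQ _ _ CF Fc.
    by apply: FI => //; exact: GF.
  - move=> c d cd [F CF Fc]; exists F => //.
    by have [[_ _ Fup] _ _] := CQ _ _ CF Fc; exact: Fup Fc.
have Qa : Q [set z | a <= z]%classic.
  split=> //=; last exact/negP.
  split=> /= [|c d ac ad|c d cd ac]; first exact: lex1.
    by rewrite lexI ac ad.
  exact: le_trans cd.
have [M0|QM] := PM.
  exfalso; apply: (maxM [set z | a <= z]%classic); last by right.
  by rewrite M0; split=> // /(_ a (lexx a)).
have [[Mt MI Mup] Ma nMb] := QM.
have maxb c : ~ M c -> exists2 x, M x & x `&` c <= b.
  move=> nMc; apply: contrapT => nx.
  case: (maxM (fun z => exists2 x, M x & x `&` c <= z)).
    split=> [z Mz|sub]; first by exists z => //; exact: leIl.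
    by apply: nMc; apply: sub; exists \top => //; exact: leIr.
  right; split=> //; last by exists a => //; exact: leIl.
  split=> [|d e [x Mx xd] [y My ye]|d e de [x Mx xd]].
  - by exists \top => //; exact: lex1.
  - exists (x `&` y); first exact: MI.
    rewrite lexI (le_trans _ xd) ?(le_trans _ ye) //.
      by rewrite leI2 ?leIr.
    by rewrite leI2 ?leIl.
  - by exists x => //; exact: le_trans de.
unshelve eexists (exist _ M _); last by [].
split=> [||c d Mcd].
- exact: (IsFilter Mt MI Mup).
- by move=> M0; apply: nMb; apply: Mup M0; exact: le0x.
apply: contrapT => /not_orP[/maxb[x Mx xc] /maxb[y My yd]].
apply: nMb; apply: (@Mup ((x `&` y) `&` (c `|` d))); last exact/MI/Mcd/MI.
rewrite meetUr leUx (le_trans _ xc) ?(le_trans _ yd) //.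
  by rewrite leI2 ?leIr.
by rewrite leI2 ?leIl.
Qed.

Definition stone (a : H) : set prime_filter := [set x | sval x a].

Lemma stone_le (a b : H) : (stone a `<=` stone b)%classic -> a <= b.
Proof.
move=> sab; apply: contrapT => /negP/prime_filter_separation[x [xa xb]].
exact/xb/sab.
Qed.

Lemma stone_inj : injective stone.
Proof. by move=> a b ab; apply/le_anti/andP; split; apply: stone_le; rewrite ab. Qed.

Lemma stone0 : stone \bot = set0.
Proof. by rewrite -subset0 => -[F [? ? ?]]. Qed.

Lemma stone1 : stone \top = setT.
Proof. by apply/seteqP; split=> // -[F [[? ? ?] ? ?]] _. Qed.

Lemma stoneI (a b : H) : stone (a `&` b) = (stone a `&` stone b)%classic.
Proof.
apply/seteqP; split=> -[F [[Ft FI Fup] F0 FU]]; rewrite /stone /=.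
  by move=> Fab; split; apply: Fup Fab; rewrite ?leIl ?leIr.
by case; exact: FI.
Qed.

Lemma stoneU (a b : H) : stone (a `|` b) = (stone a `|` stone b)%classic.
Proof.
apply/seteqP; split=> -[F [[Ft FI Fup] F0 FU]]; rewrite /stone /=.
  exact: FU.
by case; apply: Fup; rewrite ?leUl ?leUr.
Qed.

Inductive generated : set (set prime_filter) :=
  | gen_stone a : generated (stone a)
  | gen_bot : generated set0
  | gen_top : generated setT
  | gen_meet U V : generated U -> generated V -> generated (U `&` V)%classic
  | gen_join U V : generated U -> generated V -> generated (U `|` V)%classic
  | gen_compl U : generated U -> generated (~` U)%classic.

Definition cnf (s : seq (H * H)) : set prime_filter :=
  \big[setI/setT]_(p <- s) (~` stone p.1 `|` stone p.2)%classic.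

Definition cnf_box (s : seq (H * H)) : H := \meet_(p <- s) himp p.1 p.2.

Lemma cnfP s (x : prime_filter) :
  cnf s x <-> forall p, p \in s -> sval x p.1 -> sval x p.2.
Proof.
rewrite /cnf; elim: s => [|p s IHs]; first by rewrite big_nil.
rewrite big_cons; split=> [[px /IHs sx] q|sx].
  by rewrite inE => /predU1P[->|/sx//]; case: px.
split; last by apply/IHs => q qs; apply: sx; rewrite inE qs orbT.
have [xp|nxp] := pselect (sval x p.1); last by left.
by right; apply: sx xp; exact: mem_head.
Qed.

Lemma cnf_cat s t : cnf (s ++ t) = (cnf s `&` cnf t)%classic.
Proof.
apply/seteqP; split=> x.
  by move=> /cnfP st; split; apply/cnfP => p ps; apply: st; rewrite mem_cat ps ?orbT.
by case=> /cnfP xs /cnfP xt; apply/cnfP => p; rewrite mem_cat => /orP[/xs|/xt].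
Qed.

Lemma cnf_join s t :
  cnf [seq (p.1 `&` q.1, p.2 `|` q.2) | p <- s, q <- t] =
  (cnf s `|` cnf t)%classic.
Proof.
apply/seteqP; split=> x; last first.
  have [[Ft FI Fup] F0 FU] := svalP x.
  case=> /cnfP xst; apply/cnfP => _ /allpairsP[[p q] [ps qt ->]] /= pq.
    by apply: (Fup p.2); rewrite ?leUl //; apply: xst => //; apply: Fup pq; exact: leIl.
  by apply: (Fup q.2); rewrite ?leUr //; apply: xst => //; apply: Fup pq; exact: leIr.
have [[Ft FI Fup] F0 FU] := svalP x.
move=> /cnfP xst; apply: contrapT => /not_orP[ns nt]; apply: ns; apply/cnfP => p ps xp.
apply: contrapT => np; apply: nt; apply/cnfP => q qt xq.
have /FU[//|//] : sval x (p.2 `|` q.2).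
by apply: (xst (p.1 `&` q.1, p.2 `|` q.2)); [exact: allpairs_f|exact: FI].
Qed.

Lemma cnf_stone a : cnf [:: (\top, a)] = stone a.
Proof. by rewrite /cnf big_seq1 /= stone1 setCT set0U. Qed.

Lemma cnf_complE s : exists t, (~` cnf s)%classic = cnf t.
Proof.
elim: s => [|p s [t st]].
  by exists [:: (\top, \bot)]; rewrite cnf_stone stone0 /cnf big_nil setCT.
exists [seq (q.1 `&` r.1, q.2 `|` r.2)
       | q <- [:: (\top, p.1); (p.2, \bot)], r <- t].
rewrite cnf_join -st -[p :: s]/([:: p] ++ s) cnf_cat setCI; congr setU.
rewrite /cnf big_seq1 big_cons big_seq1 /= setCU setCK stone1 stone0 setCT.
by rewrite set0U setU0.
Qed.

Lemma generated_cnf U : generated U -> exists s, U = cnf s.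
Proof.
elim=> [a|||V W _ [s ->] _ [t ->]|V W _ [s ->] _ [t ->]|V _ [s ->]].
- by exists [:: (\top, a)]; rewrite cnf_stone.
- by exists [:: (\top, \bot)]; rewrite cnf_stone stone0.
- by exists [::]; rewrite /cnf big_nil.
- by exists (s ++ t); rewrite cnf_cat.
- by exists [seq (p.1 `&` q.1, p.2 `|` q.2) | p <- s, q <- t]; rewrite cnf_join.
- exact: cnf_complE.
Qed.

Lemma cnf_box_cnf s : (stone (cnf_box s) `<=` cnf s)%classic.
Proof.
move=> x xs; apply/cnfP => p ps xp; have [[Ft FI Fup] F0 FU] := svalP x.
apply: (Fup _ _ (himp_mp p.1 p.2)); apply: FI => //; apply: Fup xs.
exact: meets_inf_seq.
Qed.

Lemma cnf_box_le s t : (cnf s `<=` cnf t)%classic -> cnf_box s <= cnf_box t.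
Proof.
move=> st; apply/meetsP_seq => p pt _.
rewrite -le_himp; apply: stone_le; rewrite stoneI => x [/cnf_box_cnf/st/cnfP xt].
exact: xt.
Qed.

Definition is_generated : pred (set prime_filter) := fun U => `[< generated U >].

Definition envelope : Type := {U : set prime_filter | is_generated U}.

HB.instance Definition _ := SubChoice.on envelope.

Let gen_meet' : {in is_generated &, forall U V, Order.meet U V \in is_generated}.
Proof. by move=> U V /asboolP gU /asboolP gV; apply/asboolP; exact: gen_meet. Qed.

Let gen_join' : {in is_generated &, forall U V, Order.join U V \in is_generated}.
Proof. by move=> U V /asboolP gU /asboolP gV; apply/asboolP; exact: gen_join. Qed.

Let gen_bot' : \bot \in is_generated.
Proof. by apply/asboolP; exact: gen_bot. Qed.

Let gen_top' : \top \in is_generated.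
Proof. by apply/asboolP; exact: gen_top. Qed.

HB.instance Definition _ := Order.isTBLatticeClosed.Build _ _ is_generated
  gen_meet' gen_join' gen_bot' gen_top'.

HB.instance Definition _ :=
  [SubChoice_isTBSubLattice of envelope by <: with alg_display].

Lemma val_envI (U V : envelope) : val (U `&` V) = (val U `&` val V)%classic.
Proof. exact: Order.valI_subproof. Qed.

Lemma val_envU (U V : envelope) : val (U `|` V) = (val U `|` val V)%classic.
Proof. exact: Order.valU_subproof. Qed.

Lemma val_env0 : val (\bot : envelope) = set0.
Proof. exact: SubK. Qed.

Lemma val_env1 : val (\top : envelope) = setT.
Proof. exact: SubK. Qed.

Lemma env_le (U V : envelope) : (U <= V) <-> (val U `<=` val V)%classic.
Proof. by rewrite -Order.le_val; split=> [/asboolP|?]; last exact/asboolP. Qed.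

Let env_meetUl : @left_distributive envelope envelope Order.meet Order.join.
Proof. by move=> x y z; apply: val_inj; rewrite !(val_envI, val_envU) setIUl. Qed.

HB.instance Definition _ :=
  Order.Lattice_Meet_isDistrLattice.Build alg_display envelope env_meetUl.

Let env_compl_subproof (U : envelope) : is_generated (~` val U)%classic.
Proof. by apply/asboolP/gen_compl/asboolP/(valP U). Qed.

Definition env_compl (U : envelope) : envelope := Sub _ (env_compl_subproof U).

Let env_joinxC (U : envelope) : U `|` env_compl U = \top.
Proof. by apply: val_inj; rewrite val_envU val_env1 SubK setUv. Qed.

Let env_meetxC (U : envelope) : U `&` env_compl U = \bot.
Proof. by apply: val_inj; rewrite val_envI val_env0 SubK setICr. Qed.

HB.instance Definition _ := Order.TBDistrLattice_hasComplement.Build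
  alg_display envelope env_joinxC env_meetxC.

Let env_stone_subproof (a : H) : is_generated (stone a).
Proof. exact/asboolP/gen_stone. Qed.

Definition env_stone (a : H) : envelope := Sub _ (env_stone_subproof a).

Lemma env_cnf_ex (U : envelope) : exists s, val U = cnf s.
Proof. exact/generated_cnf/asboolP/(valP U). Qed.

Definition env_cnf (U : envelope) : seq (H * H) := sval (cid (env_cnf_ex U)).

Lemma env_cnfE U : val U = cnf (env_cnf U).
Proof. exact: (svalP (cid (env_cnf_ex U))). Qed.

(* [env_cnf] picks one presentation of [U]; by [env_boxE] any other gives the
   same value. *)
Definition env_box (U : envelope) : envelope := env_stone (cnf_box (env_cnf U)).

Lemma env_boxE (U : envelope) s :
  val U = cnf s -> env_box U = env_stone (cnf_box s).
Proof.
move=> Us; congr env_stone; apply/le_anti/andP.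
by split; apply: cnf_box_le; rewrite -Us -env_cnfE.
Qed.

Lemma env_box_stone a : env_box (env_stone a) = env_stone a.
Proof.
rewrite (@env_boxE _ [:: (\top, a)]) ?cnf_stone ?SubK //.
by rewrite /cnf_box big_seq1 himp1x.
Qed.

Let env_box1 : env_box \top = \top.
Proof.
rewrite (@env_boxE _ [::]) ?val_env1 /cnf /cnf_box ?big_nil //.
by apply: val_inj; rewrite SubK stone1 val_env1.
Qed.

Let env_boxI (U V : envelope) : env_box (U `&` V) = env_box U `&` env_box V.
Proof.
rewrite (@env_boxE _ (env_cnf U ++ env_cnf V)) ?cnf_cat -?env_cnfE ?val_envI //.
by apply: val_inj; rewrite val_envI !SubK /cnf_box big_cat stoneI.
Qed.

Let env_box_le (U : envelope) : env_box U <= U.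
Proof. by apply/env_le; rewrite SubK [X in (_ `<=` X)%classic]env_cnfE; exact: cnf_box_cnf. Qed.

Let env_le_boxbox (U : envelope) : env_box U <= env_box (env_box U).
Proof. by have -> : env_box (env_box U) = env_box U by exact: env_box_stone. Qed.

HB.instance Definition _ :=
  hasS4Box.Build envelope env_box1 env_boxI env_box_le env_le_boxbox.

End PrimeFilters.

(* Closed under isomorphism, so as to send varieties to varieties. *)
Definition rho_class (K : s4AlgType -> Prop) (H : heytingType) : Prop :=
  exists (B : s4AlgType) (f : H -> open_alg B),
    [/\ K B, heyting_hom f & bijective f].

Definition sigma_class (P : heytingType -> Prop) : s4AlgType -> Prop :=
  opH (opS (opP (fun A => exists2 H : heytingType, P H & A = envelope H))).

Inductive mform : Set :=
  | MVar of nat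
  | MTop
  | MBot
  | MAnd of mform & mform
  | MOr of mform & mform
  | MNeg of mform
  | MBox of mform.

Definition MImp (phi psi : mform) : mform := MOr (MNeg phi) psi.

Inductive iform : Set :=
  | IVar of nat
  | ITop
  | IBot
  | IAnd of iform & iform
  | IOr of iform & iform
  | IImp of iform & iform.

Fixpoint msubst (s : nat -> mform) (phi : mform) : mform :=
  match phi with
  | MVar n => s n
  | MTop => MTop
  | MBot => MBot
  | MAnd a b => MAnd (msubst s a) (msubst s b)
  | MOr a b => MOr (msubst s a) (msubst s b)
  | MNeg a => MNeg (msubst s a)
  | MBox a => MBox (msubst s a)
  end.

Fixpoint isubst (s : nat -> iform) (phi : iform) : iform :=
  match phi with
  | IVar n => s n
  | ITop => ITop
  | IBot => IBot
  | IAnd a b => IAnd (isubst s a) (isubst s b)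
  | IOr a b => IOr (isubst s a) (isubst s b)
  | IImp a b => IImp (isubst s a) (isubst s b)
  end.

Fixpoint GMT (phi : iform) : mform :=
  match phi with
  | IVar n => MBox (MVar n)
  | ITop => MTop
  | IBot => MBot
  | IAnd a b => MAnd (GMT a) (GMT b)
  | IOr a b => MOr (GMT a) (GMT b)
  | IImp a b => MBox (MOr (MNeg (GMT a)) (GMT b))
  end.

Fixpoint meval (B : s4AlgType) (v : nat -> B) (phi : mform) : B :=
  match phi with
  | MVar n => v n
  | MTop => \top
  | MBot => \bot
  | MAnd a b => meval v a `&` meval v b
  | MOr a b => meval v a `|` meval v b
  | MNeg a => ~` meval v a
  | MBox a => box (meval v a)
  end.

Definition Log (K : s4AlgType -> Prop) : set mform :=
  fun phi => forall B : s4AlgType, K B -> forall v : nat -> B, meval v phi = \top.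

(* Boxed subformulas are treated as atoms, so [tautology] holds exactly of the
   modal instances of classical propositional tautologies. *)
Fixpoint beval (v : mform -> bool) (phi : mform) : bool :=
  match phi with
  | MVar _ | MBox _ => v phi
  | MTop => true
  | MBot => false
  | MAnd a b => beval v a && beval v b
  | MOr a b => beval v a || beval v b
  | MNeg a => ~~ beval v a
  end.

Definition tautology (phi : mform) : Prop := forall v, beval v phi.

Inductive S4 : set mform :=
  | S4_taut phi : tautology phi -> S4 phi
  | S4_K phi psi :
      S4 (MImp (MBox (MImp phi psi)) (MImp (MBox phi) (MBox psi)))
  | S4_T phi : S4 (MImp (MBox phi) phi)
  | S4_4 phi : S4 (MImp (MBox phi) (MBox (MBox phi)))
  | S4_mp phi psi : S4 (MImp phi psi) -> S4 phi -> S4 psi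
  | S4_nec phi : S4 phi -> S4 (MBox phi).

Record NExtS4 (L : set mform) : Prop := mkNExtS4 {
  NExtS4_S4 : (S4 `<=` L)%classic;
  NExtS4_mp : forall phi psi, L (MImp phi psi) -> L phi -> L psi;
  NExtS4_nec : forall phi, L phi -> L (MBox phi);
  NExtS4_subst : forall s phi, L phi -> L (msubst s phi)
}.

Inductive IPC : set iform :=
  | IPC_k a b : IPC (IImp a (IImp b a))
  | IPC_s a b c :
      IPC (IImp (IImp a (IImp b c)) (IImp (IImp a b) (IImp a c)))
  | IPC_andl a b : IPC (IImp (IAnd a b) a)
  | IPC_andr a b : IPC (IImp (IAnd a b) b)
  | IPC_andI a b : IPC (IImp a (IImp b (IAnd a b)))
  | IPC_orl a b : IPC (IImp a (IOr a b))
  | IPC_orr a b : IPC (IImp b (IOr a b))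
  | IPC_orE a b c :
      IPC (IImp (IImp a c) (IImp (IImp b c) (IImp (IOr a b) c)))
  | IPC_bot a : IPC (IImp IBot a)
  | IPC_top : IPC ITop
  | IPC_mp a b : IPC (IImp a b) -> IPC a -> IPC b.

Record ExtIPC (L : set iform) : Prop := mkExtIPC {
  ExtIPC_IPC : (IPC `<=` L)%classic;
  ExtIPC_mp : forall a b, L (IImp a b) -> L a -> L b;
  ExtIPC_subst : forall s a, L a -> L (isubst s a)
}.

Definition modal_companion (M : set mform) (L : set iform) : Prop :=
  [/\ NExtS4 M, ExtIPC L & forall phi, L phi <-> M (GMT phi)].

Definition greatest_modal_companion (M : set mform) (L : set iform) : Prop :=
  modal_companion M L /\
  forall M', modal_companion M' L -> (M' `<=` M)%classic.

Definition rho_logic (M : set mform) : set iform := fun phi => M (GMT phi).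

Definition box_variant (L : set mform) : set mform :=
  fun phi => L (msubst (fun n => MBox (MVar n)) phi).

Definition Schem (L : set mform) : set mform :=
  fun phi => forall s, L (msubst s phi).

Definition box_maximal (L : set mform) : Prop :=
  forall S, NExtS4 S -> box_variant L = box_variant S -> (S `<=` L)%classic.

(* Main.v *)
From HB Require Import structures.
From mathcomp Require Import all_boot all_order.
Require Import Defs.
From mathcomp Require Import boolp classical_sets.

(** Both halves rest on one observation: in an S4-algebra, an element obtained
    from open elements by the operations is a Boolean combination of open
    elements, hence a finite meet of clauses [~` c `|` d] with [c] and [d] open,
    and the box of such a meet is the meet of the Heyting implications from [c]
    to [d].

    Equality of logics.  Since equations are inherited by homomorphic images,
    subalgebras and products, the logic of [sigma_class P] is the set of
    formulas valid in all envelopes [envelope H] with [P H] ([Log_sigma]).  Let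
    [f] be a Heyting homomorphism from [H] to the open elements of [B].  Every
    prime filter of [B] restricts along [f] to a prime filter of [H], so sending
    [cnf s] to the corresponding meet of clauses in [B] is well defined and is
    an S4-homomorphism ([env_emb_hom]); it reflects [\top] when [f] is
    injective ([env_emb_eq1]).  When [f] is bijective, the image is the
    subalgebra of [B] generated by the open elements.  Now [phi] belongs to
    [Schem (box_variant (Log K))] exactly when [phi] takes the value [\top] in
    each [B] of [K] under all valuations given by modal formulas whose variables
    range over open elements, that is, under all valuations in that generated
    subalgebra.  This is validity of [phi] in the envelope.

    Maximality.  The modal companions of [rho_logic L] are the normal extensions
    [M] with [rho_logic M = rho_logic L], so it suffices that [rho_logic] and
    [box_variant] identify the same logics ([box_variant_eq_rho]).  Each
    determines the other.  Up to S4-equivalence, [GMT phi] does not change when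
    its variables are boxed, so [rho_logic L] can be read off [box_variant L].
    Conversely, by the observation above, the box of a formula with boxed
    variables is equivalent to the translation of a meet of intuitionistic
    implications ([box_variant_rho]).  The equivalences are checked in
    S4-algebras and carried over to all normal extensions by the completeness of
    [S4], for which the Lindenbaum algebra serves ([S4_complete]). *)

Set Implicit Arguments.
Unset Strict Implicit.
Unset Printing Implicit Defensive.

Import Order.Theory.
Local Open Scope order_scope.

(** * Preservation of validity by HSP *)

Lemma meval_msubst (B : s4AlgType) (v : nat -> B) s phi :
  meval v (msubst s phi) = meval (fun n => meval v (s n)) phi.
Proof. by elim: phi => //= [a -> b ->|a -> b ->|a ->|a ->]. Qed.

Lemma s4_hom_meval (A B : s4AlgType) (f : A -> B) (v : nat -> A) phi :
  s4_hom f -> f (meval v phi) = meval (f \o v) phi.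
Proof.
case=> f0 f1 fI fU fC fbox.
elim: phi => //= [a <- b <-|a <- b <-|a <-|a <-].
- exact: fI.
- exact: fU.
- exact: fC.
- exact: fbox.
Qed.

Lemma s4_hom_proj I (B : I -> s4AlgType) i :
  s4_hom (fun g : s4_prod B => g i).
Proof. by []. Qed.

Lemma valid_opH (K : s4AlgType -> Prop) phi : Log K phi -> Log (opH K) phi.
Proof.
move=> Kphi A [B [f [KB fhom fsurj]]] v.
have [w wE] := choice (fun n => fsurj (v n)).
have -> : v = f \o w by apply/funext => n /=; rewrite wE.
by rewrite -s4_hom_meval // Kphi // s4_hom1.
Qed.

Lemma valid_opS (K : s4AlgType -> Prop) phi : Log K phi -> Log (opS K) phi.
Proof.
move=> Kphi A [B [f [KB fhom finj]]] v; apply: finj.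
by rewrite s4_hom_meval // Kphi // s4_hom1.
Qed.

Lemma valid_opP (K : s4AlgType -> Prop) phi : Log K phi -> Log (opP K) phi.
Proof.
move=> Kphi A [I [B [f [KB fhom /bij_inj finj]]]] v; apply: finj.
rewrite s4_hom_meval // s4_hom1 //; apply/functional_extensionality_dep => i.
rewrite (s4_hom_meval _ _ (s4_hom_proj B i)); exact: Kphi.
Qed.

Lemma sigma_class_envelope (P : heytingType -> Prop) (H : heytingType) :
  P H -> sigma_class P (envelope H).
Proof.
move=> PH; exists (envelope H), id; split=> //; last by move=> a; exists a.
exists (envelope H), id; split=> //.
exists unit, (fun=> envelope H : s4AlgType), (fun a _ => a); split=> //.
  by move=> _; exists H.
exists (fun g => g tt) => // g.
by apply/functional_extensionality_dep => -[].
Qed.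

Lemma Log_sigma (P : heytingType -> Prop) phi :
  Log (sigma_class P) phi <->
  (forall H, P H -> forall v : nat -> envelope H, meval v phi = \top).
Proof.
split=> [sPphi H PH v|Pphi]; first exact/sPphi/sigma_class_envelope.
by apply/valid_opH/valid_opS/valid_opP => _ [H PH ->]; exact: Pphi.
Qed.

(** * The envelope of a Heyting algebra of open elements *)

Lemma le_compl_join (B : s4AlgType) (a b : B) :
  (a <= b) = (~` a `|` b == \top).
Proof. by rewrite -le1x -leBLR diffE meet1x complK. Qed.

(** A copy of the underlying Boolean algebra, made a Heyting algebra, so that
    the prime filter theorem applies to [A]. *)
Definition heyting_of (A : s4AlgType) : Type := A.

Section HeytingOf.
Variable A : s4AlgType.

HB.instance Definition _ := Order.CTBDistrLattice.on (heyting_of A).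

Let le_imp (a b c : heyting_of A) : (a `&` b <= c) = (a <= ~` b `|` c).
Proof. by rewrite -leBLR diffE complK. Qed.

HB.instance Definition _ := hasHeytingImp.Build (heyting_of A) le_imp.

Lemma stoneC (a : heyting_of A) : stone (~` a) = (~` stone a)%classic.
Proof.
apply/seteqP; split=> x xa.
  move=> xb; have : setI (stone a) (stone (~` a)) x by [].
  by rewrite -stoneI meetxC stone0.
have : stone (a `|` ~` a) x by rewrite joinxC stone1.
by rewrite stoneU => -[].
Qed.

End HeytingOf.

Section Embedding.
Variables (H : heytingType) (A : s4AlgType) (f : H -> open_alg A).
Hypothesis fhom : heyting_hom f.

Let pullback_subproof (x : prime_filter (heyting_of A)) :
  is_prime_filter [set a | sval x (val (f a) : heyting_of A)]%classic.
Proof.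
have [[xt xI xup] x0 xU] := svalP x; case: fhom => f0 f1 fI fU _.
split=> [||a b] /=.
- split=> /= [|a b xa xb|a b ab].
  + by rewrite f1.
  + by rewrite fI val_openI; exact: xI.
  + by rewrite -{1}(meet_l ab) fI val_openI; apply: xup; exact: leIr.
- by rewrite f0.
- by rewrite fU val_openU; exact: xU.
Qed.

(** The map dual to [f]; it is what compares clauses over [H] with their images
    in [A]. *)
Definition pullback (x : prime_filter (heyting_of A)) : prime_filter H :=
  exist _ _ (pullback_subproof x).

Definition env_emb (U : envelope H) : A :=
  \meet_(p <- env_cnf U) (~` val (f p.1) `|` val (f p.2)).

(** This describes [env_emb U] by [U] alone, whatever presentation [env_cnf]
    picks; as [stone] is injective, the Boolean operations are then preserved
    because preimages preserve them. *)
Lemma stone_env_emb U :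
  stone (env_emb U : heyting_of A) = (pullback @^-1` val U)%classic.
Proof.
rewrite /env_emb env_cnfE /cnf.
elim: (env_cnf U) => [|p s IHs]; first by rewrite !big_nil stone1.
by rewrite !big_cons stoneI IHs stoneU stoneC.
Qed.

Lemma env_emb_stone a : env_emb (env_stone a) = val (f a).
Proof. by apply: (@stone_inj (heyting_of A)); rewrite stone_env_emb. Qed.

(** The box is preserved since it commutes with finite meets and since [f] sends
    [himp c d] to the box of the clause of [f c] and [f d]. *)
Lemma env_emb_hom : s4_hom env_emb.
Proof.
have inj := @stone_inj (heyting_of A).
have [f0 f1 fI fU fimp] := fhom.
split=> [||U V|U V|U|U].
- by apply: inj; rewrite stone_env_emb stone0 val_env0 preimage_set0.
- by apply: inj; rewrite stone_env_emb stone1 val_env1 preimage_setT.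
- by apply: inj; rewrite stoneI !stone_env_emb val_envI preimage_setI.
- by apply: inj; rewrite stoneU !stone_env_emb val_envU preimage_setU.
- by apply: inj; rewrite stoneC !stone_env_emb -preimage_setC.
- rewrite env_emb_stone /cnf_box (big_morph box boxI box1).
  rewrite -[LHS]/((val \o f) _).
  rewrite (big_morph _ (id1 := \top) (op1 := Order.meet)) /=.
  + by apply: eq_bigr => p _; rewrite fimp.
  + by move=> a b; rewrite /= fI val_openI.
  + by rewrite /= f1.
Qed.

(** If the meet of the clauses of [U] is [\top], then [f c <= f d] for each
    clause, so [c <= d], and every prime filter of [H] satisfies the clause. *)
Lemma env_emb_eq1 : injective f -> forall U, env_emb U = \top -> U = \top.
Proof.
move=> finj U U1; apply: val_inj; rewrite val_env1 env_cnfE -subTset => x _.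
apply/cnfP => p ps; have [[xt xI xup] x0 xU] := svalP x; apply: xup.
rewrite leEmeet; apply/eqP/finj/val_inj.
rewrite (heyting_homI fhom) val_openI; apply: meet_l.
by rewrite le_compl_join -le1x -[leLHS]U1; exact: meets_inf_seq.
Qed.

End Embedding.

(** * The logic of the envelopes as the schematic part of the box-variant *)

Definition boxed (phi : mform) : mform := msubst (fun n => MBox (MVar n)) phi.

Lemma meval_boxed (B : s4AlgType) (v : nat -> B) phi :
  meval v (boxed phi) = meval (fun n => box (v n)) phi.
Proof. exact: meval_msubst. Qed.

Lemma val_open (B : s4AlgType) (a : open_alg B) : box (val a) = val a.
Proof. by apply/esym/eqP; exact: (valP a). Qed.

Definition open_val (B : s4AlgType) (v : nat -> B) (n : nat) : open_alg B :=
  Sub (box (v n)) (introT eqP (esym (box_box (v n)))).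

Lemma open_id_hom (B : s4AlgType) : heyting_hom (@id (open_alg B)).
Proof. by []. Qed.

Lemma Log_sigma_rho K :
  Log (sigma_class (rho_class K)) = Schem (box_variant (Log K)).
Proof.
apply/seteqP; split=> phi.
  move=> /Log_sigma sphi s B KB v.
  have rB : rho_class K (open_alg B).
    by exists B, id; split=> //; exists id.
  (* The values of the boxed [s n] are images of elements of the envelope. *)
  pose w n := meval (fun m => env_stone (open_val v m)) (s n).
  have ehom := env_emb_hom (open_id_hom B).
  rewrite -/(boxed _) meval_boxed meval_msubst.
  transitivity (env_emb id (meval w phi)); last by rewrite sphi // s4_hom1.
  rewrite (s4_hom_meval _ _ ehom); congr meval; apply/funext => n /=.
  rewrite (s4_hom_meval _ _ ehom); congr meval; apply/funext => m /=.
  by rewrite env_emb_stone ?SubK //; exact: open_id_hom.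
move=> Sphi; apply/Log_sigma => H [B [f [KB fhom fbij]]] w.
apply: (env_emb_eq1 fhom (bij_inj fbij)).
have ehom := env_emb_hom fhom; rewrite (s4_hom_meval _ _ ehom).
(* The value [env_emb f (w n)] is that of a formula on open elements: [s n] is
   the meet of the clauses of [w n], with a fresh variable for either side of
   each clause; the triple coded by a variable gives its index [n], the position
   of the clause and the side. *)
pose s n := \big[MAnd/MTop]_(i < size (env_cnf (w n)))
  MImp (MVar (pickle (n, nat_of_ord i, false)))
       (MVar (pickle (n, nat_of_ord i, true))).
pose v k : B := if unpickle k is Some (n, i, b) then
  let p := nth (\bot, \bot) (env_cnf (w n)) i in
  val (f (if b then p.2 else p.1)) else \bot.
rewrite -[RHS](Sphi s B KB v) -/(boxed _) meval_boxed meval_msubst.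
congr meval; apply/funext => n /=.
rewrite /env_emb (big_nth (\bot, \bot)) big_mkord /s.
rewrite (big_morph (meval _) (id1 := \top) (op1 := Order.meet)) //.
by apply: eq_bigr => i _; rewrite /= /v !pickleK !val_open.
Qed.
(** * The Lindenbaum algebra and the completeness of S4 *)

Definition MIff (phi psi : mform) : mform := MAnd (MImp phi psi) (MImp psi phi).

Lemma S4_taut1 phi psi : tautology (MImp phi psi) -> S4 phi -> S4 psi.
Proof. by move=> t; exact/S4_mp/S4_taut. Qed.

Lemma S4_taut2 phi1 phi2 psi :
  tautology (MImp phi1 (MImp phi2 psi)) -> S4 phi1 -> S4 phi2 -> S4 psi.
Proof. by move=> t S1; apply: S4_mp; exact: S4_taut1 t S1. Qed.

Ltac prove_tautology :=
  let v := fresh "v" in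
  move=> v /=; repeat match goal with |- context [beval v ?p] =>
    case: (beval v p) => //= end; repeat match goal with |- context [v ?p] =>
    case: (v p) => //= end.

Lemma S4_box_mono phi psi :
  S4 (MImp phi psi) -> S4 (MImp (MBox phi) (MBox psi)).
Proof. by move=> /S4_nec; exact/S4_mp/S4_K. Qed.

Lemma S4_box_iff phi psi : S4 (MIff phi psi) -> S4 (MIff (MBox phi) (MBox psi)).
Proof.
move=> pq.
have /S4_box_mono le_pq : S4 (MImp phi psi).
  by apply: S4_taut1 pq; prove_tautology.
have /S4_box_mono le_qp : S4 (MImp psi phi).
  by apply: S4_taut1 pq; prove_tautology.
by apply: S4_taut2 le_pq le_qp; prove_tautology.
Qed.

HB.instance Definition _ := gen_eqMixin mform.
HB.instance Definition _ := gen_choiceMixin mform.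

Definition s4_equiv (phi psi : mform) : bool := `[< S4 (MIff phi psi) >].

Lemma s4_equiv_refl : reflexive s4_equiv.
Proof. by move=> a; apply/asboolP/S4_taut; prove_tautology. Qed.

Lemma s4_equiv_sym : symmetric s4_equiv.
Proof.
by move=> a b; apply/asboolP/asboolP; apply: S4_taut1; prove_tautology.
Qed.

Lemma s4_equiv_trans : transitive s4_equiv.
Proof.
move=> b a c /asboolP ab /asboolP bc; apply/asboolP.
by apply: S4_taut2 ab bc; prove_tautology.
Qed.

Canonical s4_equiv_rel :=
  EquivRel s4_equiv s4_equiv_refl s4_equiv_sym s4_equiv_trans.

Definition lindenbaum : Type := {eq_quot s4_equiv}%qT.

HB.instance Definition _ := Choice.on lindenbaum.

Definition thm_class (phi : mform) : lindenbaum :=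
  (\pi_{eq_quot s4_equiv} phi)%qT.

Lemma thm_classP phi psi :
  thm_class phi = thm_class psi <-> S4 (MIff phi psi).
Proof. by split=> [/eqquotP/asboolP|?]; last exact/eqquotP/asboolP. Qed.

Lemma thm_class_surj (x : lindenbaum) : exists phi, x = thm_class phi.
Proof. by exists (repr x); rewrite /thm_class reprK. Qed.

Section Lindenbaum.

Let rep (x : lindenbaum) : mform := repr x.

Let rep_class phi : S4 (MIff (rep (thm_class phi)) phi).
Proof. by apply/thm_classP; rewrite /thm_class reprK. Qed.

Definition lb_meet x y := thm_class (MAnd (rep x) (rep y)).
Definition lb_join x y := thm_class (MOr (rep x) (rep y)).
Definition lb_compl x := thm_class (MNeg (rep x)).
Definition lb_box x := thm_class (MBox (rep x)).
Definition lb_le x y := lb_meet x y == x.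
Definition lb_lt x y := (y != x) && lb_le x y.

Lemma lb_meetE phi psi :
  lb_meet (thm_class phi) (thm_class psi) = thm_class (MAnd phi psi).
Proof.
apply/thm_classP; apply: S4_taut2 (rep_class phi) (rep_class psi).
by prove_tautology.
Qed.

Lemma lb_joinE phi psi :
  lb_join (thm_class phi) (thm_class psi) = thm_class (MOr phi psi).
Proof.
apply/thm_classP; apply: S4_taut2 (rep_class phi) (rep_class psi).
by prove_tautology.
Qed.

Lemma lb_complE phi : lb_compl (thm_class phi) = thm_class (MNeg phi).
Proof.
by apply/thm_classP; apply: S4_taut1 (rep_class phi); prove_tautology.
Qed.

Lemma lb_boxE phi : lb_box (thm_class phi) = thm_class (MBox phi).
Proof. exact/thm_classP/S4_box_iff/rep_class. Qed.

Let lbE := (lb_meetE, lb_joinE, lb_complE, lb_boxE).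

Ltac lb_tautology :=
  rewrite ?lbE; apply/thm_classP/S4_taut; prove_tautology.

Let lb_meetC : commutative lb_meet.
Proof.
move=> x y; have [[a ->] [b ->]] := (thm_class_surj x, thm_class_surj y).
lb_tautology.
Qed.

Let lb_joinC : commutative lb_join.
Proof.
move=> x y; have [[a ->] [b ->]] := (thm_class_surj x, thm_class_surj y).
lb_tautology.
Qed.

Let lb_meetA : associative lb_meet.
Proof.
move=> x y z; have [[a ->] [b ->]] := (thm_class_surj x, thm_class_surj y).
have [c ->] := thm_class_surj z; lb_tautology.
Qed.

Let lb_joinA : associative lb_join.
Proof.
move=> x y z; have [[a ->] [b ->]] := (thm_class_surj x, thm_class_surj y).
have [c ->] := thm_class_surj z; lb_tautology.
Qed.

Let lb_joinKI y x : lb_meet x (lb_join x y) = x.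
Proof.
have [[a ->] [b ->]] := (thm_class_surj x, thm_class_surj y); lb_tautology.
Qed.

Let lb_meetKU y x : lb_join x (lb_meet x y) = x.
Proof.
have [[a ->] [b ->]] := (thm_class_surj x, thm_class_surj y); lb_tautology.
Qed.

Let lb_meetUl : left_distributive lb_meet lb_join.
Proof.
move=> x y z; have [[a ->] [b ->]] := (thm_class_surj x, thm_class_surj y).
have [c ->] := thm_class_surj z; lb_tautology.
Qed.

Let lb_meetxx : idempotent_op lb_meet.
Proof. move=> x; have [a ->] := thm_class_surj x; lb_tautology. Qed.

HB.instance Definition _ := Order.isMeetJoinDistrLattice.Build alg_display
  lindenbaum (fun _ _ => erefl : lb_le _ _ = _)
  (fun _ _ => erefl : lb_lt _ _ = _)
  lb_meetC lb_joinC lb_meetA lb_joinA lb_joinKI lb_meetKU lb_meetUl lb_meetxx.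

Lemma lb_leP phi psi : thm_class phi <= thm_class psi <-> S4 (MImp phi psi).
Proof.
rewrite leEmeet [_ `&` _]lb_meetE.
split=> [/eqP/thm_classP|pq]; first by apply: S4_taut1; prove_tautology.
by apply/eqP/thm_classP; apply: S4_taut1 pq; prove_tautology.
Qed.

Let lb_le0x (x : lindenbaum) : thm_class MBot <= x.
Proof.
by have [a ->] := thm_class_surj x; apply/lb_leP/S4_taut; prove_tautology.
Qed.

Let lb_lex1 (x : lindenbaum) : x <= thm_class MTop.
Proof.
by have [a ->] := thm_class_surj x; apply/lb_leP/S4_taut; prove_tautology.
Qed.

HB.instance Definition _ :=
  Order.hasBottom.Build alg_display lindenbaum lb_le0x.
HB.instance Definition _ :=
  Order.hasTop.Build alg_display lindenbaum lb_lex1.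

Let lb_joinxC (x : lindenbaum) : x `|` lb_compl x = \top.
Proof.
have [a ->] := thm_class_surj x.
rewrite -[LHS]/(lb_join _ _) -[RHS]/(thm_class MTop); lb_tautology.
Qed.

Let lb_meetxC (x : lindenbaum) : x `&` lb_compl x = \bot.
Proof.
have [a ->] := thm_class_surj x.
rewrite -[LHS]/(lb_meet _ _) -[RHS]/(thm_class MBot); lb_tautology.
Qed.

HB.instance Definition _ := Order.TBDistrLattice_hasComplement.Build alg_display
  lindenbaum lb_joinxC lb_meetxC.

Let lb_box1 : lb_box \top = \top.
Proof.
rewrite lb_boxE; apply/thm_classP.
have /S4_nec : S4 MTop by apply/S4_taut; prove_tautology.
by apply: S4_taut1; prove_tautology.
Qed.

Let lb_boxI (x y : lindenbaum) : lb_box (x `&` y) = lb_box x `&` lb_box y.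
Proof.
have [[a ->] [b ->]] := (thm_class_surj x, thm_class_surj y).
rewrite [_ `&` _ in LHS]lb_meetE -[RHS]/(lb_meet _ _) !lbE; apply/thm_classP.
have Iab : S4 (MImp (MBox (MAnd a b)) (MAnd (MBox a) (MBox b))).
  have Ia : S4 (MImp (MBox (MAnd a b)) (MBox a)).
    by apply/S4_box_mono/S4_taut; prove_tautology.
  have Ib : S4 (MImp (MBox (MAnd a b)) (MBox b)).
    by apply/S4_box_mono/S4_taut; prove_tautology.
  by apply: S4_taut2 Ia Ib; prove_tautology.
have abI : S4 (MImp (MBox a) (MBox (MImp b (MAnd a b)))).
  by apply/S4_box_mono/S4_taut; prove_tautology.
have {}abI : S4 (MImp (MAnd (MBox a) (MBox b)) (MBox (MAnd a b))).
  by apply: S4_taut2 abI (S4_K b (MAnd a b)); prove_tautology.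
by apply: S4_taut2 Iab abI; prove_tautology.
Qed.

Let lb_box_le (x : lindenbaum) : lb_box x <= x.
Proof.
by have [a ->] := thm_class_surj x; rewrite lb_boxE; apply/lb_leP/S4_T.
Qed.

Let lb_le_boxbox (x : lindenbaum) : lb_box x <= lb_box (lb_box x).
Proof.
by have [a ->] := thm_class_surj x; rewrite !lb_boxE; apply/lb_leP/S4_4.
Qed.

HB.instance Definition _ :=
  hasS4Box.Build lindenbaum lb_box1 lb_boxI lb_box_le lb_le_boxbox.

End Lindenbaum.

Lemma meval_lindenbaum phi :
  meval (fun n => thm_class (MVar n)) phi = thm_class phi.
Proof.
elim: phi => //= [a -> b ->|a -> b ->|a ->|a ->].
- exact: lb_meetE.
- exact: lb_joinE.
- exact: lb_complE.
- exact: lb_boxE.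
Qed.

(** In the Lindenbaum algebra, under the valuation sending each variable to its
    own class, a formula takes the value [\top] only if it is a theorem. *)
Lemma S4_complete phi :
  (forall (B : s4AlgType) (v : nat -> B), meval v phi = \top) -> S4 phi.
Proof.
move=> /(_ lindenbaum (fun n => thm_class (MVar n))).
rewrite meval_lindenbaum => /thm_classP; apply: S4_taut1; prove_tautology.
Qed.

(** Completeness in the form used below: membership in a normal extension only
    depends on the values of a formula in S4-algebras. *)
Lemma NExtS4_equiv L phi psi : NExtS4 L ->
  (forall (B : s4AlgType) (v : nat -> B), meval v phi = meval v psi) ->
  L phi <-> L psi.
Proof.
move=> Lext pq; split; apply: (NExtS4_mp Lext); apply: (NExtS4_S4 Lext);
  by apply: S4_complete => B v /=; rewrite pq joinCx.
Qed.

(** * The intuitionistic logic of a normal extension *)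

Fixpoint heval (H : heytingType) (v : nat -> H) (phi : iform) : H :=
  match phi with
  | IVar n => v n
  | ITop => \top
  | IBot => \bot
  | IAnd a b => heval v a `&` heval v b
  | IOr a b => heval v a `|` heval v b
  | IImp a b => himp (heval v a) (heval v b)
  end.

Lemma heval_isubst (H : heytingType) (v : nat -> H) s phi :
  heval v (isubst s phi) = heval (fun n => heval v (s n)) phi.
Proof. by elim: phi => //= a -> b ->. Qed.

Lemma himp_eq1 (H : heytingType) (a b : H) : himp a b = \top <-> a <= b.
Proof.
by rewrite -{2}[a]meet1x le_himp le1x; split=> [->//|/eqP].
Qed.

Lemma IPC_sound (H : heytingType) (v : nat -> H) phi :
  IPC phi -> heval v phi = \top.
Proof.
elim=> {phi} [a b|a b c|a b|a b|a b|a b|a b|a b c|a||a b _ /himp_eq1 ab _ a1]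
  /=; try apply/himp_eq1.
- by rewrite -le_himp leIl.
- set x := heval v a; set y := heval v b; set z := heval v c.
  rewrite -!le_himp.
  set t := (_ `&` _) `&` _.
  have tx : t <= x by exact: leIr.
  have ty : t <= y.
    by apply: le_trans (himp_mp x y); rewrite lexI tx /t -meetA meetCA leIl.
  apply: le_trans (himp_mp y z); rewrite lexI ty /=.
  by apply: le_trans (himp_mp x _); rewrite lexI tx /t -meetA leIl.
- exact: leIl.
- exact: leIr.
- by rewrite -le_himp.
- exact: leUl.
- exact: leUr.
- rewrite -!le_himp meetUr leUx; apply/andP; split.
    by apply: le_trans (himp_mp _ _); rewrite meetC leI2 // leIl.
  by apply: le_trans (himp_mp _ _); rewrite meetC leI2 // leIr.
- exact: le0x.
- by [].
- by apply/eqP; rewrite -le1x -a1.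
Qed.

(** The translation computes, among all elements of [B], the Heyting value in
    the algebra of open elements. *)
Lemma meval_GMT (B : s4AlgType) (v : nat -> B) phi :
  meval v (GMT phi) = val (heval (open_val v) phi).
Proof. by elim: phi => //= a -> b ->. Qed.

Lemma ExtIPC_rho_logic L : NExtS4 L -> ExtIPC (rho_logic L).
Proof.
move=> Lext; split.
- move=> phi Iphi; apply: (NExtS4_S4 Lext); apply: S4_complete => B v.
  by rewrite meval_GMT IPC_sound.
- move=> a b Lab; apply: (NExtS4_mp Lext); apply: (NExtS4_mp Lext) Lab.
  exact/(NExtS4_S4 Lext)/S4_T.
- move=> s a /(NExtS4_subst Lext (fun n => GMT (s n))).
  apply: (NExtS4_equiv Lext _).1 => B v.
  rewrite meval_msubst !meval_GMT heval_isubst; congr val; congr heval.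
  by apply/funext => n; apply: val_inj; rewrite SubK meval_GMT val_open.
Qed.

Lemma NExtS4_box L phi : NExtS4 L -> L (MBox phi) <-> L phi.
Proof.
move=> Lext; split; last exact: (NExtS4_nec Lext).
exact/(NExtS4_mp Lext)/(NExtS4_S4 Lext)/S4_T.
Qed.

(** Boxing the variables is harmless here because [GMT] already boxes them and
    the box is idempotent. *)
Lemma box_variant_GMT L phi : NExtS4 L ->
  box_variant L (GMT phi) <-> L (GMT phi).
Proof.
move=> Lext; apply: (NExtS4_equiv (phi := boxed (GMT phi)) Lext) => B v.
rewrite meval_boxed !meval_GMT; congr val; congr heval.
by apply/funext => n; apply: val_inj; rewrite !SubK box_box.
Qed.

(** * Clausal form of a modal formula with boxed variables *)

(** A pair [(a, b)] stands for the clause [~ GMT a \/ GMT b]; a sequence stands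
    for the conjunction of its clauses, whose box is the translation of this
    formula. *)
Definition iclause_meet (s : seq (iform * iform)) : iform :=
  \big[IAnd/ITop]_(p <- s) IImp p.1 p.2.

Definition iclause_join (s t : seq (iform * iform)) : seq (iform * iform) :=
  [seq (IAnd p.1 q.1, IOr p.2 q.2) | p <- s, q <- t].

(** The negation of the clause of [a] and [b] is the conjunction of two clauses:
    [GMT a], on the pair of [ITop] and [a], and the negation of [GMT b], on the
    pair of [b] and [IBot]. *)
Definition iclause_neg (s : seq (iform * iform)) : seq (iform * iform) :=
  foldr (fun p => iclause_join [:: (ITop, p.1); (p.2, IBot)])
    [:: (ITop, IBot)] s.

(** Nested boxes are no obstacle: the box of a clausal form is again of the form
    [GMT c], which is the single clause of [ITop] and [c]. *)
Fixpoint icnf (phi : mform) : seq (iform * iform) :=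
  match phi with
  | MVar n => [:: (ITop, IVar n)]
  | MTop => [::]
  | MBot => [:: (ITop, IBot)]
  | MAnd a b => icnf a ++ icnf b
  | MOr a b => iclause_join (icnf a) (icnf b)
  | MNeg a => iclause_neg (icnf a)
  | MBox a => [:: (ITop, iclause_meet (icnf a))]
  end.

Section ClauseValue.
Variables (B : s4AlgType) (v : nat -> B).

Let val_clause (p : iform * iform) : B :=
  ~` meval v (GMT p.1) `|` meval v (GMT p.2).

Definition iclause_val (s : seq (iform * iform)) : B :=
  \meet_(p <- s) val_clause p.

Lemma iclause_val1 p :
  iclause_val [:: p] = ~` meval v (GMT p.1) `|` meval v (GMT p.2).
Proof. exact: big_seq1. Qed.

Lemma iclause_val_cons p s :
  iclause_val (p :: s) = iclause_val [:: p] `&` iclause_val s.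
Proof. by rewrite /iclause_val big_cons big_seq1. Qed.

Lemma iclause_val_cat s t :
  iclause_val (s ++ t) = iclause_val s `&` iclause_val t.
Proof. exact: big_cat. Qed.

Lemma iclause_val_join s t :
  iclause_val (iclause_join s t) = iclause_val s `|` iclause_val t.
Proof.
rewrite /iclause_val /iclause_join big_allpairs_dep /=.
elim: s => [|p s IHs]; first by rewrite !big_nil join1x.
rewrite !big_cons IHs joinIl; congr (_ `&` _).
elim: t {IHs} => [|q t IHt]; first by rewrite !big_nil joinx1.
rewrite !big_cons IHt joinIr; congr (_ `&` _).
by rewrite /val_clause /= complI joinACA.
Qed.

Lemma iclause_val_neg s : iclause_val (iclause_neg s) = ~` iclause_val s.
Proof.
elim: s => [|p s IHs] /=.
  by rewrite iclause_val1 /iclause_val big_nil /= joinx0.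
rewrite iclause_val_join IHs [iclause_val (p :: s)]iclause_val_cons complI.
congr (_ `|` _).
by rewrite iclause_val_cons !iclause_val1 /= compl1 join0x joinx0 complU complK.
Qed.

Lemma meval_iclause_meet s :
  meval v (GMT (iclause_meet s)) = box (iclause_val s).
Proof.
rewrite /iclause_meet /iclause_val (big_morph box boxI box1).
rewrite -[LHS]/((meval v \o GMT) _).
by rewrite (big_morph _ (id1 := \top) (op1 := Order.meet)).
Qed.

Lemma meval_icnf phi : meval v (boxed phi) = iclause_val (icnf phi).
Proof.
elim: phi => [n|||a IHa b IHb|a IHa b IHb|a IHa|a IHa] /=.
- by rewrite iclause_val1 /= compl1 join0x.
- by rewrite /iclause_val big_nil.
- by rewrite iclause_val1 /= compl1 join0x.
- by rewrite iclause_val_cat -IHa -IHb.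
- by rewrite iclause_val_join -IHa -IHb.
- by rewrite iclause_val_neg -IHa.
- by rewrite iclause_val1 meval_iclause_meet -IHa /= compl1 join0x.
Qed.

End ClauseValue.

(** * Box-maximality *)

Lemma box_variant_rho L phi : NExtS4 L ->
  box_variant L phi <-> rho_logic L (iclause_meet (icnf phi)).
Proof.
move=> Lext; apply: iff_trans (iff_sym (NExtS4_box (boxed phi) Lext)) _.
apply: NExtS4_equiv => // B v.
by rewrite meval_iclause_meet -meval_icnf.
Qed.

Lemma box_variant_eq_rho L S : NExtS4 L -> NExtS4 S ->
  box_variant L = box_variant S <-> rho_logic L = rho_logic S.
Proof.
move=> Lext Sext; split=> LS; apply/seteqP; split=> phi.
- by move=> /(box_variant_GMT _ Lext); rewrite LS => /(box_variant_GMT _ Sext).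
- by move=> /(box_variant_GMT _ Sext); rewrite -LS => /(box_variant_GMT _ Lext).
- by move=> /(box_variant_rho _ Lext); rewrite LS => /(box_variant_rho _ Sext).
- by move=> /(box_variant_rho _ Sext); rewrite -LS => /(box_variant_rho _ Lext).
Qed.

Lemma modal_companion_rho M L : NExtS4 M -> NExtS4 L ->
  modal_companion M (rho_logic L) <-> rho_logic L = rho_logic M.
Proof.
move=> Mext Lext; split=> [[_ _ LM]|LM].
  by apply/seteqP; split=> phi /LM.
by split=> // [|phi]; [exact: ExtIPC_rho_logic|rewrite LM].
Qed.

(** By [modal_companion_rho] and [box_variant_eq_rho], box-maximality of [L] and
    being greatest among the companions of [rho_logic L] compare [L] with the
    same logics. *)
Theorem corollary6p8 :
  (forall K : s4AlgType -> Prop, variety K ->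
     Log (sigma_class (rho_class K)) = Schem (box_variant (Log K)))
  /\
  (forall L : set mform, NExtS4 L ->
     (box_maximal L <-> greatest_modal_companion L (rho_logic L))).
Proof.
split=> [K _|L Lext]; first exact: Log_sigma_rho.
split=> [Lmax|[_ Lgreat] S Sext /(box_variant_eq_rho Lext Sext) LS].
  split=> [|M MC]; first exact/modal_companion_rho.
  have [Mext _ _] := MC.
  by apply: Lmax => //; apply/box_variant_eq_rho/modal_companion_rho.
by apply: Lgreat; apply/modal_companion_rho.
Qed.
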